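(* Let $n>r>s$ be positive integers such that $ns=r^2$, and let $\omega(n,r,s)$ be the clique number of the generalized Johnson graph $J(n,r,s)$. Then $$f(n)\geq\omega(n,r,s)+2.$$
   Context: The generalized Johnson graph $J(n,r,s)$ is the graph whose vertices are all $r$-element subsets of $\{1,2,\ldots,n\}$, where two vertices $A$ and $B$ are adjacent if and only if $|A\cap B|=s$. The clique number of a graph is the maximum cardinality of a clique in it. For a positive integer $n$ let $\Omega=\{1,2,\ldots,n\}$ be the sample space with $n$ sample points, with the classical (uniform) probability $\mathbb{P}(A)=|A|/n$ for every event $A\subseteq\Omega$. Two events $A,B\subseteq\Omega$ are independent if $\mathbb{P}(A\cap B)=\mathbb{P}(A)\mathbb{P}(B)$, i.e. $|A\cap B|=n^{-1}|A||B|$. Distinct events $A_1,\ldots,A_t\subseteq\Omega$ are pairwise independent if $A_i$ and $A_j$ are independent for all $1\leq i<j\leq t$. The number $f(n)$ denotes the maximum number $t$ of distinct pairwise independent events in $\Omega$ (the events $\emptyset$ and $\Omega$ are allowed). *)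

(* Defs.v *)
From mathcomp Require Import all_boot all_order all_algebra.

Set Implicit Arguments.
Unset Strict Implicit.
Unset Printing Implicit Defensive.

Import Order.TTheory GRing.Theory Num.Theory.

(* The n-point set {1, ..., n} is represented by 'I_n = {0, ..., n - 1}. *)

Definition clique (T : finType) (e : rel T) (K : {set T}) : bool :=
  [forall x in K, forall y in K, (x != y) ==> e x y].

Definition clique_number (T : finType) (e : rel T) : nat :=
  \max_(K : {set T} | clique e K) #|K|.

(* For r = s this relation also holds between a vertex and itself; it is
   irreflexive, hence a simple graph, whenever r <> s. *)
Definition johnson_adj (n r s : nat) : rel {A : {set 'I_n} | #|A| == r} :=
  fun A B => #|val A :&: val B| == s.

Definition johnson_clique_number (n r s : nat) : nat :=
  clique_number (@johnson_adj n r s).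

Definition Pr (n : nat) (A : {set 'I_n}) : rat := (#|A|%:R / n%:R)%R.

Definition independent (n : nat) (A B : {set 'I_n}) : bool :=
  Pr (A :&: B) == (Pr A * Pr B)%R.

(* Only pairs of different events are tested: an event need not be independent
   of itself. *)
Definition pairwise_independent (n : nat) (S : {set {set 'I_n}}) : bool :=
  [forall A in S, forall B in S, (A != B) ==> independent A B].

Definition max_pairwise_independent (n : nat) : nat :=
  \max_(S : {set {set 'I_n}} | pairwise_independent S) #|S|.

(* Main.v *)
Require Import Defs.
From mathcomp Require Import all_boot all_order all_algebra.

(** Since [n s = r ^ 2], adjacency in [J(n, r, s)] is exactly independence of
    two [r]-subsets. The empty and the full event are independent of every event
    and, as [0 < r < n], differ from the members of a clique; adding them to a
    maximum clique gives the bound. *)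

(** Cross-multiplying the fractions leaves a common factor [n], which cancels because it is
    positive; from here on everything is arithmetic in [nat]. *)
Lemma independentE (n : nat) (A B : {set 'I_n}) : 0 < n ->
  independent A B = (n * #|A :&: B| == #|A| * #|B|).
Proof.
move=> n_gt0; rewrite /independent /Pr.
have n_neq0 : (n%:R != 0 :> rat)%R by rewrite Num.Theory.pnatr_eq0 -lt0n.
rewrite GRing.mulf_div GRing.eqr_div ?GRing.mulf_neq0 //.
rewrite -!GRing.natrM Num.Theory.eqr_nat.
by rewrite mulnA eqn_pmul2r // mulnC.
Qed.

Lemma independentC (n : nat) (A B : {set 'I_n}) :
  independent A B = independent B A.
Proof. by rewrite /independent setIC GRing.mulrC. Qed.

Lemma independent_set0 (n : nat) (A : {set 'I_n}) : 0 < n ->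
  independent set0 A.
Proof. by move=> n_gt0; rewrite independentE // set0I cards0 muln0. Qed.

Lemma independent_setT (n : nat) (A : {set 'I_n}) : 0 < n ->
  independent [set: 'I_n] A.
Proof. by move=> n_gt0; rewrite independentE // setTI cardsT card_ord. Qed.

(** The case [B = A] of the first hypothesis forces [#|A|] to be [0] or [n], so the lemma serves
    exactly the two trivial events. *)
Lemma pairwise_independentU1 (n : nat) (A : {set 'I_n})
    (S : {set {set 'I_n}}) :
  (forall B, independent A B) -> pairwise_independent S ->
  pairwise_independent (A |: S).
Proof.
move=> indA /forall_inP indS.
apply/forall_inP => B /setU1P[-> | BS]; apply/forall_inP => C.
  by rewrite indA implybT.
case/setU1P => [-> | CS]; first by rewrite independentC indA implybT.
by have /forall_inP := indS B BS; apply.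
Qed.

Lemma johnson_clique_independent (n r s : nat)
    (K : {set {A : {set 'I_n} | #|A| == r}}) :
  0 < n -> n * s = r ^ 2 -> clique (@johnson_adj n r s) K ->
  pairwise_independent [set val A | A in K].
Proof.
move=> n_gt0 ns_eq /forall_inP clK.
apply/forall_inP => _ /imsetP[A AK ->]; apply/forall_inP => _ /imsetP[B BK ->].
apply/implyP; rewrite (inj_eq val_inj) => neqAB.
have /forall_inP/(_ B BK)/implyP/(_ neqAB)/eqP AB := clK A AK.
by rewrite independentE // AB ns_eq (eqP (valP A)) (eqP (valP B)).
Qed.

Theorem proposition3p1 (n r s : nat) (s_gt0 : 0 < s) (s_lt_r : s < r)
    (r_lt_n : r < n) (ns_eq : n * s = r ^ 2) :
  johnson_clique_number n r s + 2 <= max_pairwise_independent n.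
Proof.
have r_gt0 : 0 < r := ltn_trans s_gt0 s_lt_r.
have n_gt0 : 0 < n := ltn_trans r_gt0 r_lt_n.
(* The maximum is attained by some clique [K] once the family of cliques is nonempty; the empty
   clique witnesses this. *)
have [|K clK maxK] := @eq_bigmax_cond _ [pred K | clique (@johnson_adj n r s) K]
  (fun K => #|K|).
  by apply/card_gt0P; exists set0; apply/forall_inP => A; rewrite inE.
rewrite (_ : johnson_clique_number n r s = #|K|); last exact: maxK.
set S := [set val A | A in K].
have cardS A : A \in S -> #|A| = r.
  by case/imsetP => B _ ->; exact/eqP/(valP B).
have TnotinS : [set: 'I_n] \notin S.
  apply/negP => /cardS; rewrite cardsT card_ord => n_r.
  by rewrite n_r ltnn in r_lt_n.
have set0_notin : set0 \notin [set: 'I_n] |: S.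
  (* Comparing cardinalities, [set0 = [set: 'I_n]] would give [0 = n], and [set0 \in S] would give
     [0 = r]. *)
  apply/negP => /setU1P[/(congr1 (fun A : {set _} => #|A|)) | /cardS];
    by rewrite cards0 ?cardsT ?card_ord => zero; rewrite -zero in n_gt0 r_gt0.
(* Each insertion adds a new event, and injectivity of [val] gives [#|S| = #|K|]. *)
have -> : #|K| + 2 = #|set0 |: ([set: 'I_n] |: S)|.
  by rewrite cardsU1 set0_notin cardsU1 TnotinS (card_imset _ val_inj) addn2.
apply: (@leq_bigmax_cond _ _ (fun S : {set {set 'I_n}} => #|S|)).
apply: pairwise_independentU1 => [B|]; first exact: independent_set0.
apply: pairwise_independentU1 => [B|]; first exact: independent_setT.
exact: johnson_clique_independent ns_eq clK.
Qed.
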